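(* As congruences between formal power series in $q$ with integer coefficients (coefficientwise), \[ \sum_{n\ge0}\overline{p}_3(3n)(-q)^n\equiv \frac{\varphi(q^3)}{\varphi(q)^4}\pmod{9\cdot 2^3}, \] \[ \sum_{n\ge0}\overline{p}_3(3n+1)(-q)^n\equiv 6\,\frac{\varphi(q^3)^4}{\varphi(q)^8}\,B(-q)\pmod{9\cdot 2^4}, \] \[ \sum_{n\ge0}\overline{p}_3(3n+2)(-q)^n\equiv 24\,\frac{\varphi(q^3)^3}{\varphi(q)^8}\,B(-q)^2\pmod{9\cdot 2^5}. \]
   Context: $\overline{p}_3(n)$ denotes the number of overpartition triples of $n$ (triples of overpartitions whose parts together sum to $n$, where an overpartition is a partition in which the first occurrence of each distinct part may be overlined), with $\overline{p}_3(0)=1$; equivalently $\sum_{n\ge0}\overline{p}_3(n)q^n=1/\varphi(-q)^3$. Here $(a;q)_\infty=\prod_{n\ge0}(1-aq^n)$, $\varphi(q)=\sum_{n=-\infty}^{\infty}q^{n^2}$, and \[B(q)=\frac{(q;q)_\infty (q^6;q^6)_\infty^2}{(q^2;q^2)_\infty (q^3;q^3)_\infty}.\] *)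

(* Defs.v *)
From HB Require Import structures.
From mathcomp Require Import all_boot all_order all_algebra.
From mathcomp Require Import boolp.

Set Implicit Arguments.
Unset Strict Implicit.
Unset Printing Implicit Defensive.

Import Order.TTheory GRing.Theory Num.Theory.
Local Open Scope ring_scope.

Record fps : Type := Fps { coef : nat -> int }.

Lemma fpsP (f g : fps) : coef f =1 coef g -> f = g.
Proof. by case: f g => [f] [g] /= /funext->. Qed.

HB.instance Definition _ := gen_eqMixin fps.
HB.instance Definition _ := gen_choiceMixin fps.

Definition fps_zero := Fps (fun=> 0).
Definition fps_opp (f : fps) := Fps (fun n => - coef f n).
Definition fps_add (f g : fps) := Fps (fun n => coef f n + coef g n).
Definition fps_one := Fps (fun n => (n == 0)%:R).
Definition fps_mul (f g : fps) :=
  Fps (fun n => \sum_(i < n.+1) coef f i * coef g (n - i)).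

Fact fps_addA : associative fps_add.
Proof. by move=> f g h; apply: fpsP => n /=; rewrite addrA. Qed.
Fact fps_addC : commutative fps_add.
Proof. by move=> f g; apply: fpsP => n /=; rewrite addrC. Qed.
Fact fps_add0 : left_id fps_zero fps_add.
Proof. by move=> f; apply: fpsP => n /=; rewrite add0r. Qed.
Fact fps_addN : left_inverse fps_zero fps_opp fps_add.
Proof. by move=> f; apply: fpsP => n /=; rewrite addNr. Qed.

HB.instance Definition _ :=
  GRing.isZmodule.Build fps fps_addA fps_addC fps_add0 fps_addN.

Lemma coef_fps_mul (p r : {poly int}) (f g : fps) (n : nat) :
    (forall i, (i <= n)%N -> p`_i = coef f i) ->
    (forall i, (i <= n)%N -> r`_i = coef g i) ->
  coef (fps_mul f g) n = (p * r)`_n.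
Proof.
move=> pf rg; rewrite coefM /=; apply: eq_bigr => i _.
by rewrite pf ?rg ?leq_subr // -ltnS.
Qed.

Fact fps_mulA : associative fps_mul.
Proof.
move=> f g h; apply: fpsP => n.
pose T (u : fps) := \poly_(i < n.+1) coef u i.
have TE u i : (i <= n)%N -> (T u)`_i = coef u i.
  by move=> le_in; rewrite coef_poly ltnS le_in.
have TM u v i : (i <= n)%N -> (T u * T v)`_i = coef (fps_mul u v) i.
  move=> le_in; rewrite (@coef_fps_mul (T u) (T v)) // => j le_ji;
    by apply: TE; apply: leq_trans le_in.
rewrite (coef_fps_mul (TE f) (TM g h)) (coef_fps_mul (TM f g) (TE h)).
by rewrite mulrA.
Qed.

Fact fps_mulC : commutative fps_mul.
Proof.
move=> f g; apply: fpsP => n.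
pose T (u : fps) := \poly_(i < n.+1) coef u i.
have TE u i : (i <= n)%N -> (T u)`_i = coef u i.
  by move=> le_in; rewrite coef_poly ltnS le_in.
by rewrite (coef_fps_mul (TE f) (TE g)) (coef_fps_mul (TE g) (TE f)) mulrC.
Qed.

Fact fps_mul1 : left_id fps_one fps_mul.
Proof.
move=> f; apply: fpsP => n /=.
rewrite big_ord_recl /= subn0 mul1r big1 ?addr0 // => i _.
by rewrite mul0r.
Qed.

Fact fps_mulDl : left_distributive fps_mul fps_add.
Proof.
move=> f g h; apply: fpsP => n /=; rewrite -big_split /=.
by apply: eq_bigr => i _; rewrite mulrDl.
Qed.

Fact fps_one_neq0 : fps_one != 0.
Proof. by apply/eqP => /(congr1 (coef^~ 0%N)). Qed.

HB.instance Definition _ := GRing.Zmodule_isComNzRing.Build fps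
  fps_mulA fps_mulC fps_mul1 fps_mulDl fps_one_neq0.

Lemma fps_coef1 n : coef 1 n = (n == 0)%:R. Proof. by []. Qed.
Lemma fps_coefN f n : coef (- f) n = - coef f n. Proof. by []. Qed.
Lemma fps_coefD f g n : coef (f + g) n = coef f n + coef g n.
Proof. by []. Qed.
Lemma fps_coefM f g n :
  coef (f * g) n = \sum_(i < n.+1) coef f i * coef g (n - i).
Proof. by []. Qed.
Lemma fps_coef_sum I (r : seq I) (P : pred I) (F : I -> fps) n :
  coef (\sum_(i <- r | P i) F i) n = \sum_(i <- r | P i) coef (F i) n.
Proof. by elim/big_rec2: _ => // i u v _ <-. Qed.

Lemma fps_coefX_small (f : fps) (k n : nat) :
  coef f 0 = 0 -> (n < k)%N -> coef (f ^+ k) n = 0.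
Proof.
move=> f0; elim: k n => // k IHk n lt_nk.
rewrite exprS fps_coefM big1 // => -[[|i] /= lt_in] _; first by rewrite f0 mul0r.
rewrite IHk ?mulr0 //; apply: (@leq_trans n) => //.
by rewrite ltn_subrL; apply: leq_ltn_trans (lt_in : (i < n)%N).
Qed.

(* If f has constant term 1 or -1, then f ^+ 2 has constant term 1, and        *)
(* 1 / f = f * \sum_k (1 - f ^+ 2) ^+ k; only the terms k <= n of the geometric *)
(* series contribute to its coefficient of index n.                            *)
Definition fps_unit : pred fps := fun f => coef f 0 \is a GRing.unit.
Definition fps_geom (h : fps) : fps :=
  Fps (fun n => coef (\sum_(k < n.+1) h ^+ k) n).
Definition fps_inv (f : fps) : fps :=
  if fps_unit f then f * fps_geom (1 - f ^+ 2) else f.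

Lemma fps_geomP (h : fps) : coef h 0 = 0 -> fps_geom h * (1 - h) = 1.
Proof.
move=> h0; apply: fpsP => n; rewrite fps_coefM.
transitivity (coef ((\sum_(k < n.+1) h ^+ k) * (1 - h)) n).
  rewrite fps_coefM; apply: eq_bigr => -[i /= le_in] _; congr (_ * _).
  rewrite !fps_coef_sum -!(big_mkord xpredT (fun k => coef (h ^+ k) i)).
  rewrite (@big_cat_nat _ _ _ i.+1 0 n.+1) //=.
  rewrite [X in _ = _ + X](_ : _ = 0) ?addr0 // big_nat big1 // => k /andP[lt_ik _].
  exact: fps_coefX_small.
rewrite mulrC -opprB mulNr -subrX1 opprB fps_coefD fps_coefN.
by rewrite fps_coefX_small // subr0.
Qed.

Fact fps_mulVf : {in fps_unit, left_inverse 1 fps_inv *%R}.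
Proof.
move=> f Uf; rewrite /fps_inv ifT // mulrAC -expr2 mulrC.
rewrite -[f ^+ 2 in X in _ * X](subKr 1) fps_geomP //.
rewrite fps_coefD fps_coefN fps_coefM big_ord1 subn0 /=.
by have /orP[/eqP->|/eqP->] : (coef f 0 == 1) || (coef f 0 == -1) := Uf.
Qed.

Fact fps_unitPl (f g : fps) : g * f = 1 -> fps_unit f.
Proof.
move=> /(congr1 (coef^~ 0%N)); rewrite fps_coefM big_ord1 subn0 fps_coef1 /=.
by move=> gf1; apply/unitrPr; exists (coef g 0); rewrite mulrC.
Qed.

Fact fps_invN : {in [predC fps_unit], fps_inv =1 id}.
Proof. by move=> f /negbTE Uf; rewrite /fps_inv ifF. Qed.

HB.instance Definition _ := GRing.ComNzRing_hasMulInverse.Build fps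
  fps_mulVf fps_unitPl fps_invN.

Definition q : fps := Fps (fun n => (n == 1)%:R).

(* Substitution f(g) = \sum_k f_k g^k, meaningful when g has constant term 0:  *)
(* the terms k > n then do not contribute to the coefficient of index n.       *)
Definition fps_comp (f g : fps) : fps :=
  Fps (fun n => \sum_(k < n.+1) coef f k * coef (g ^+ k) n).
Coercion fps_comp : fps >-> Funclass.

Definition fps_eqmod (m : int) (f g : fps) : Prop :=
  forall n : nat, (coef f n = coef g n %[mod m])%Z.
Declare Scope fps_scope.
Delimit Scope fps_scope with FPS.
Notation "f = g %[mod m ]" := (fps_eqmod m f g) : fps_scope.

(* (a; b)_oo; meaningful when b has constant term 0: the factors i > n are     *)
(* then congruent to 1 modulo q^(n+1).                                         *)
Definition qpoch (a b : fps) : fps :=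
  Fps (fun n => coef (\prod_(i < n.+1) (1 - a * b ^+ i)) n).

(* The index j stands for the integer j - n: every root of m^2 = n satisfies   *)
(* - n <= m <= n.                                                              *)
Definition phi : fps :=
  Fps (fun n => #|[set j : 'I_(n.*2.+1) | (j%:Z - n%:Z) ^+ 2 == n%:Z]|%:Z).

Definition B : fps :=
  qpoch q q * qpoch (q ^+ 6) (q ^+ 6) ^+ 2
    / (qpoch (q ^+ 2) (q ^+ 2) * qpoch (q ^+ 3) (q ^+ 3)).

(* The sequence of parts, each paired with its overlining mark. An overlined   *)
(* part must be strictly smaller than the part before it, so that it is the    *)
(* first occurrence of its value.                                              *)
Definition overpartition (s : seq (nat * bool)) : bool :=
  all (fun x => 0 < x.1)%N s &&
  sorted (fun x y => (y.1 < x.1) || (y.1 == x.1) && ~~ y.2)%N s.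

Definition weight (s : seq (nat * bool)) : nat := \sum_(x <- s) x.1.

(* An overpartition of an integer at most n has at most n parts, each at most  *)
(* n, so these finite types contain all the triples counted by p3bar.          *)
Definition bounded_seq (n : nat) := n.-bseq ('I_n.+1 * bool).

Definition parts (n : nat) (s : bounded_seq n) : seq (nat * bool) :=
  [seq (val x.1, x.2) | x <- s].

Definition p3bar (n : nat) : nat :=
  #|[set t : bounded_seq n * bounded_seq n * bounded_seq n |
     [&& overpartition (parts t.1.1), overpartition (parts t.1.2),
         overpartition (parts t.2)
       & weight (parts t.1.1) + weight (parts t.1.2) + weight (parts t.2)
           == n]%N]|.

(* Main.v *)
Require Import Defs.
From HB Require Import structures.
From mathcomp Require Import all_boot all_order all_algebra.
From mathcomp Require Import ring zify.

(* The overpartition series is P = 1 / phi(-q), by Gauss's product for        *)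
(* phi(-q).  The 3-dissection phi(q) = a(q^3) + 2 q b(q^3), with              *)
(* a(q) = phi(q^3) and b(q) = B(-q), follows from the Jacobi triple product.  *)
(* Inverting it gives the three components of P(-q) as                        *)
(* a^2 / D, - 2 a b / D and 4 b^2 / D, where D = a^3 + 8 q b^3 is the norm of *)
(* phi from Z[[q^(1/3)]] to Z[[q]].  Computing that norm factor by factor on  *)
(* the product gives D = phi^4 / a.  In the components of P(-q)^3 the leading *)
(* terms, rewritten in terms of D, are the right-hand sides, and the          *)
(* remainders carry the explicit factors 72, 144 and 288.                     *)

Set Implicit Arguments.
Unset Strict Implicit.
Unset Printing Implicit Defensive.

Import GRing.Theory.
Local Open Scope ring_scope.
Local Open Scope fps_scope.

(** * Truncation and limits of power series *)

(** Put t = q^(1/3), a = phi(q^3), b = B(-q) and x = 2 t b. The dissection of phi ([tris0_phi],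
    [tris1_phi], [tris2_phi]) reads phi(t) = a + x, whence 1/phi(t) = (a^2 - a x + x^2) / D with D =
    a^3 + x^3 = a^3 + 8 q b^3 ([tris_p]). The generating function of overpartition triples at -t is
    the cube of this series ([p3bar_gf], [overpartition_gf_phi]). Sorting (a^2 - a x + x^2)^3 by the
    exponent of x modulo 3 gives D^2 - 9 a^3 x^3, then -3 a^2 x D + 9 a^2 x^4, then 6 a x^2 D - 9 a
    x^5. The coefficient 9 and the powers of 2 inside x^3, x^4, x^5 are the three moduli. The
    leading terms become the stated quotients through D phi(q^3) = phi(q)^4 ([normE]). This holds
    because D is the norm of phi(t): the norm is multiplicative, and it is computed on each factor
    of the product for phi ([norm3_qpoch], [norm3_phi]). The products for phi(-q) and for B are
    instances of [triple_product]; the combinatorial input is [overpartition_gf], proved by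
    recursion on the largest part. *)

Lemma coef_fpsZn (f : fps) k n : coef (f *+ k) n = coef f n *+ k.
Proof. by elim: k => // k IHk; rewrite !mulrSr fps_coefD IHk. Qed.

Lemma coef_qM f n : coef (q * f) n = if n is m.+1 then coef f m else 0.
Proof.
rewrite fps_coefM; case: n => [|n]; first by rewrite big_ord1 mul0r.
rewrite big_ord_recl mul0r add0r big_ord_recl /= mul1r subSS subn0.
by rewrite big1 ?addr0 // => i _; rewrite mul0r.
Qed.

Lemma coef_qX k n : coef (q ^+ k) n = (n == k)%:R.
Proof.
elim: k n => [|k IHk] n; first by rewrite fps_coef1.
by rewrite exprS coef_qM; case: n => // n; rewrite IHk.
Qed.

Lemma coef_signM k f n : coef ((-1) ^+ k * f) n = (-1) ^+ k * coef f n.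
Proof.
elim: k => [|k IHk]; first by rewrite !mul1r.
by rewrite !exprS -!mulrA !mulN1r fps_coefN IHk.
Qed.

Lemma fps_unitE (f : fps) : (f \is a GRing.unit) = (coef f 0 \is a GRing.unit).
Proof. by []. Qed.

Lemma coef0M f g : coef (f * g) 0 = coef f 0 * coef g 0.
Proof. by rewrite fps_coefM big_ord1 subn0. Qed.

Lemma coef0X f n : coef (f ^+ n) 0 = coef f 0 ^+ n.
Proof. by elim: n => [|n IHn]; rewrite ?fps_coef1 // !exprS coef0M IHn. Qed.

Definition eqX (n : nat) (f g : fps) := forall i, (i < n)%N -> coef f i = coef g i.

Lemma eqX_sym n f g : eqX n f g -> eqX n g f.
Proof. by move=> fg i /fg. Qed.

Lemma eqX_trans n f g h : eqX n f g -> eqX n g h -> eqX n f h.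
Proof. by move=> fg gh i lt_in; rewrite fg ?gh. Qed.

Lemma eqX_leq m n f g : (m <= n)%N -> eqX n f g -> eqX m f g.
Proof. by move=> le_mn fg i /leq_trans/(_ le_mn)/fg. Qed.

Lemma eqXD n f f' g g' : eqX n f f' -> eqX n g g' -> eqX n (f + g) (f' + g').
Proof. by move=> ff gg i lt_in; rewrite !fps_coefD ff ?gg. Qed.

Lemma eqXM n f f' g g' : eqX n f f' -> eqX n g g' -> eqX n (f * g) (f' * g').
Proof.
move=> ff gg i lt_in; rewrite !fps_coefM; apply: eq_bigr => j _.
by rewrite ff ?gg //; have := ltn_ord j; lia.
Qed.

Lemma eqX_exp n k f g : eqX n f g -> eqX n (f ^+ k) (g ^+ k).
Proof. by move=> fg; elim: k => // k IHk; rewrite !exprS; apply: eqXM. Qed.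

Lemma eqX_sum n I (r : seq I) (P : pred I) F G :
  (forall i, P i -> eqX n (F i) (G i)) ->
  eqX n (\sum_(i <- r | P i) F i) (\sum_(i <- r | P i) G i).
Proof.
by move=> FG; apply: (big_ind2 (eqX n)) => // f f' g g'; apply: eqXD.
Qed.

Lemma eqX_prod n I (r : seq I) (P : pred I) F G :
  (forall i, P i -> eqX n (F i) (G i)) ->
  eqX n (\prod_(i <- r | P i) F i) (\prod_(i <- r | P i) G i).
Proof.
by move=> FG; apply: (big_ind2 (eqX n)) => // f f' g g'; apply: eqXM.
Qed.

Lemma eqX0_expM n k f g : coef f 0 = 0 -> (n <= k)%N -> eqX n (f ^+ k * g) 0.
Proof.
move=> f0 le_nk; apply: (@eqX_trans _ _ (0 * g)); last by rewrite mul0r.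
apply: eqXM => // i lt_in.
by rewrite fps_coefX_small //; apply: leq_trans le_nk.
Qed.

(** Convergence in the q-adic topology with a prescribed speed: the n-th term is already correct
    modulo q^n. This avoids an existential rank; in exchange, reindexings must satisfy n <= s n. *)
Definition cvg (u : nat -> fps) (f : fps) := forall n, eqX n (u n) f.

Lemma cvg_unique u f g : cvg u f -> cvg u g -> f = g.
Proof. by move=> uf ug; apply: fpsP => i; rewrite -(uf i.+1) ?(ug i.+1). Qed.

Lemma eq_cvg u v f : u =1 v -> cvg u f -> cvg v f.
Proof. by move=> uv uf n; rewrite -uv. Qed.

Lemma cvg_sub u f s : cvg u f -> (forall n, n <= s n)%N -> cvg (u \o s) f.
Proof. by move=> uf les n; apply: eqX_leq (uf _). Qed.

Lemma cvg_cst f : cvg (fun=> f) f.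
Proof. by []. Qed.

Lemma cvgD u v f g : cvg u f -> cvg v g -> cvg (fun n => u n + v n) (f + g).
Proof. by move=> uf vg n; apply: eqXD. Qed.

Lemma cvgM u v f g : cvg u f -> cvg v g -> cvg (fun n => u n * v n) (f * g).
Proof. by move=> uf vg n; apply: eqXM. Qed.

Lemma cvgX u f k : cvg u f -> cvg (fun n => u n ^+ k) (f ^+ k).
Proof. by move=> uf n; apply: eqX_exp. Qed.

Lemma cvg_prod I (r : seq I) (u : I -> nat -> fps) (f : I -> fps) :
  (forall i, cvg (u i) (f i)) ->
  cvg (fun n => \prod_(i <- r) u i n) (\prod_(i <- r) f i).
Proof. by move=> uf n; apply: eqX_prod => i _; apply: uf. Qed.

(** * Finite q-Pochhammer products and their limits *)

Definition fpoch (R : comNzRingType) (a b : R) n : R := \prod_(i < n) (1 - a * b ^+ i).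

Lemma fpochS (R : comNzRingType) (a b : R) n :
  fpoch a b n.+1 = fpoch a b n * (1 - a * b ^+ n).
Proof. exact: big_ord_recr. Qed.

(** The factors of index i >= m are 1 modulo q^m, since b has no constant term and so q^i divides
    b^i. *)
Lemma eqX_fpoch a b m n : coef b 0 = 0 -> (m <= n)%N ->
  eqX m (fpoch a b n) (fpoch a b m).
Proof.
move=> b0 /subnK<-; elim: (n - m)%N => // k IHk; rewrite addSn fpochS.
rewrite -[X in eqX _ _ X]mulr1; apply: eqXM => //.
rewrite -[X in eqX _ _ X]subr0; apply: eqXD => // i lt_im.
by rewrite !fps_coefN mulrC (eqX0_expM a b0 _ lt_im) // leq_addl.
Qed.

Lemma cvg_qpoch a b : coef b 0 = 0 -> cvg (fpoch a b) (qpoch a b).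
Proof. by move=> b0 n i lt_in; rewrite /= (eqX_fpoch a b0 lt_in). Qed.

Lemma coef0_qpoch a b : coef (qpoch a b) 0 = 1 - coef a 0.
Proof. by rewrite /qpoch /= big_ord1 mulr1. Qed.

(** The factors are grouped by the residue modulo d of the exponent of b. *)
Lemma fpoch_split (R : comNzRingType) d (a b : R) n :
  fpoch a b (d * n) = \prod_(r < d) fpoch (a * b ^+ r) (b ^+ d) n.
Proof.
elim: n => [|n IHn].
  by rewrite muln0 /fpoch big_ord0 big1 // => r _; rewrite big_ord0.
under eq_bigr => r _ do rewrite fpochS.
rewrite big_split -IHn /= mulnS addnC /fpoch big_split_ord /=; congr (_ * _).
by apply: eq_bigr => r _; rewrite addnC exprD exprM mulrA.
Qed.

Lemma qpoch_split d a b : (0 < d)%N -> coef b 0 = 0 ->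
  qpoch a b = \prod_(r < d) qpoch (a * b ^+ r) (b ^+ d).
Proof.
move=> d_gt0 b0.
have cvg1 := cvg_sub (cvg_qpoch a b0) (fun n => leq_pmull n d_gt0).
apply: cvg_unique cvg1 _; apply: eq_cvg (fsym (@fpoch_split _ d a b)) _.
by apply: cvg_prod => r; apply: cvg_qpoch; rewrite coef0X b0 expr0n eqn0Ngt d_gt0.
Qed.

(** * The Jacobi triple product *)

Section Jacobi.
Context (R : comNzRingType).
Implicit Types (x y Q : R).

(** Gaussian binomials, defined by the q-Pascal rule rather than as quotients, so that they make
    sense in any commutative ring. *)
Fixpoint qbin Q (n k : nat) : R :=
  match n, k with
  | _, 0 => 1
  | 0, _.+1 => 0
  | n'.+1, k'.+1 => qbin Q n' k' + Q ^+ k * qbin Q n' k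
  end.

Lemma qbin0 Q n : qbin Q n 0 = 1. Proof. by case: n. Qed.

Lemma qbin_small Q n k : (n < k)%N -> qbin Q n k = 0.
Proof.
elim: n k => [|n IHn] [|k] //= lt_nk.
by rewrite !IHn ?mulr0 ?addr0 // ltnW.
Qed.

Lemma qbinn Q n : qbin Q n n = 1.
Proof. by elim: n => //= n ->; rewrite qbin_small // mulr0 addr0. Qed.

Lemma qbinS Q n k :
  qbin Q n.+1 k.+1 = qbin Q n k + Q ^+ k.+1 * qbin Q n k.+1.
Proof. by []. Qed.

(** The dual q-Pascal rule. Both rules are needed because the triple product grows at its two
    ends. *)
Lemma qbinS' Q n k : (k <= n)%N ->
  qbin Q n.+1 k.+1 = qbin Q n k.+1 + Q ^+ (n - k) * qbin Q n k.
Proof.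
elim: n k => [|n IHn] k le_kn; first
  by case: k le_kn => // _; rewrite /= mulr0 subnn expr0 mulr1 addrC.
case: (ltngtP k n.+1) le_kn => // [lt_kn _|-> _]; last first.
  by rewrite !qbinn qbin_small // subnn mulr1 add0r.
case: k lt_kn => [_|k lt_kn]; last first.
  rewrite qbinS [in LHS]IHn 1?ltnW // [in LHS]IHn //.
  rewrite [qbin Q n.+1 k.+2]qbinS [qbin Q n.+1 k.+1]qbinS.
  have -> : (n.+1 - k.+1 = (n - k.+1).+1)%N by lia.
  have -> : (n - k = (n - k.+1).+1)%N by lia.
  by rewrite !exprS; ring.
rewrite qbinS [in LHS]IHn // [qbin Q n.+1 1]qbinS !qbin0 !subn0 !exprS expr0.
by ring.
Qed.

Definition theta_term x Q j := x ^+ j * Q ^+ 'C(j, 2).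

(* With j = k - m in Z, this is x ^ j (x y) ^ (j (j - 1) / 2); for j < 0 the  *)
(* inverse powers of x are absorbed into those of y.                          *)
Definition theta_bi x y m k : R :=
  if (m <= k)%N then theta_term x (x * y) (k - m)
  else theta_term y (x * y) (m - k).

Lemma theta_termS x y j :
  theta_term x (x * y) j.+1 = x * (x * y) ^+ j * theta_term x (x * y) j.
Proof. by rewrite /theta_term binS bin1 exprS !exprD; ring. Qed.

(** Consecutive terms have ratio x Q^(k - m) with Q = x y; multiplying by Q^(m + n - k) clears the
    negative power. This is the effect on one term of the new factor 1 + x Q^n. *)
Lemma theta_bi_up x y m k n : (k <= m + n)%N ->
  x * (x * y) ^+ n * theta_bi x y m k = (x * y) ^+ (m + n - k) * theta_bi x y m k.+1.
Proof.
move=> le_k; rewrite /theta_bi; case: (leqP m k) => [le_mk|lt_km].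
  rewrite ltnW ?ltnS // subSn // theta_termS.
  have -> : (n = (m + n - k) + (k - m))%N by lia.
  rewrite exprD; have -> : (m + (m + n - k + (k - m)) - k = m + n - k)%N by lia.
  by ring.
have -> : (m + n - k = n + (m - k.+1).+1)%N by lia.
have -> : (m - k = (m - k.+1).+1)%N by lia.
rewrite [x * y]mulrC theta_termS exprD; case: (ltngtP m k.+1) => [|_|->].
- lia.
- by rewrite exprS; ring.
by rewrite subnn /theta_term !expr0; ring.
Qed.

(** The counterpart for a new factor 1 + y Q^m, which moves the centre of the bilateral sum from m
    to m + 1. *)
Lemma theta_bi_down x y m k :
  y * (x * y) ^+ m * theta_bi x y m k = (x * y) ^+ k * theta_bi x y m.+1 k.
Proof.
rewrite /theta_bi; case: (ltngtP m k) => [lt_mk|lt_km|->].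
- have -> : (k - m = (k - m.+1).+1)%N by lia.
  rewrite theta_termS -{3}(subnKC lt_mk) exprD exprS; ring.
- rewrite subSn 1?ltnW // [x * y]mulrC theta_termS -{1}(subnKC (ltnW lt_km)).
  by rewrite exprD; ring.
by rewrite subnn subSnn [x * y]mulrC theta_termS /theta_term !expr0; ring.
Qed.

Lemma theta_biSS x y m k : theta_bi x y m.+1 k.+1 = theta_bi x y m k.
Proof. by rewrite /theta_bi ltnS !subSS. Qed.

Lemma sum_qbinS Q n (T : nat -> R) :
  \sum_(k < n.+2) qbin Q n.+1 k * T k =
  \sum_(k < n.+1) qbin Q n k * (Q ^+ k * T k + T k.+1).
Proof.
rewrite big_ord_recl qbin0 mul1r; under eq_bigr => k _ do
  rewrite lift0 qbinS mulrDl.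
rewrite big_split /= addrCA addrC [in RHS](eq_bigr (fun k : 'I_n.+1 =>
  Q ^+ k * qbin Q n k * T k + qbin Q n k * T k.+1)); last by move=> k _; ring.
rewrite big_split /=; congr (_ + _).
rewrite [in RHS]big_ord_recl qbin0 expr0 !mul1r; congr (_ + _).
rewrite big_ord_recr /= qbin_small // mulr0 mul0r addr0.
by apply: eq_bigr.
Qed.

Lemma sum_qbinS' Q n (T : nat -> R) :
  \sum_(k < n.+2) qbin Q n.+1 k * T k =
  \sum_(k < n.+1) qbin Q n k * (T k + Q ^+ (n - k) * T k.+1).
Proof.
rewrite big_ord_recl qbin0 mul1r (eq_bigr (fun k : 'I_n.+1 =>
  qbin Q n k.+1 * T k.+1 + Q ^+ (n - k) * qbin Q n k * T k.+1)); last first.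
  by move=> k _; rewrite lift0 qbinS' ?mulrDl // -ltnS.
rewrite big_split /= addrA [in RHS](eq_bigr (fun k : 'I_n.+1 =>
  qbin Q n k * T k + Q ^+ (n - k) * qbin Q n k * T k.+1)); last first.
  by move=> k _; ring.
rewrite big_split /=; congr (_ + _).
rewrite [in RHS]big_ord_recl qbin0 !mul1r; congr (_ + _).
by rewrite big_ord_recr /= qbin_small // mul0r addr0.
Qed.

(** Each additional factor on the left is one q-Pascal rule on the right: the first rule when m
    grows (done with n = 0), the dual rule when n grows. *)
Lemma finite_triple_product x y m n :
  fpoch (- y) (x * y) m * fpoch (- x) (x * y) n =
  \sum_(k < (m + n).+1) qbin (x * y) (m + n) k * theta_bi x y m k.
Proof.
elim: n => [|n IHn]; last first.
  rewrite fpochS mulrA IHn addnS sum_qbinS' mulr_suml; apply: eq_bigr => k _.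
  rewrite -mulrA; congr (_ * _); rewrite -theta_bi_up; first by ring.
  by rewrite -ltnS.
rewrite {2}/fpoch big_ord0 mulr1 addn0; elim: m => [|m IHm].
  by rewrite big_ord1 /fpoch big_ord0 /theta_bi /theta_term /= !expr0 !mulr1.
rewrite fpochS IHm sum_qbinS mulr_suml; apply: eq_bigr => k _.
by rewrite -mulrA; congr (_ * _); rewrite theta_biSS -theta_bi_down; ring.
Qed.

(** The usual quotient formula for Gaussian binomials, with denominators cleared; induction on k + l
    through the q-Pascal rule. *)
Lemma qbin_fpoch Q k l :
  qbin Q (k + l) k * (fpoch Q Q k * fpoch Q Q l) = fpoch Q Q (k + l).
Proof.
elim: (k + l)%N {-2}k {-2}l (erefl (k + l)%N) => {k l} [|n IHn] k l def_n.
  move/eqP: def_n; rewrite addn_eq0 => /andP[/eqP-> /eqP->].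
  by rewrite /fpoch big_ord0 /= !mulr1.
case: k l def_n => [|k] [|l] def_n.
- by rewrite /= mul1r /fpoch big_ord0 mul1r.
- by rewrite /= mul1r /fpoch big_ord0 mul1r.
- by rewrite addn0 qbinn mul1r /fpoch big_ord0 mulr1.
have [] : (k + l.+1)%N = n /\ (k.+1 + l)%N = n by lia.
move=> def1 def2; have := IHn _ _ def2; have := IHn _ _ def1.
rewrite def1 def2 def_n qbinS.
rewrite [fpoch Q Q k.+1]fpochS [fpoch Q Q l.+1]fpochS [fpoch Q Q n.+1]fpochS.
move=> IH1 IH2; transitivity
  (qbin Q n k * (fpoch Q Q k * (fpoch Q Q l * (1 - Q * Q ^+ l)))
     * (1 - Q * Q ^+ k)
   + qbin Q n k.+1 * (fpoch Q Q k * (1 - Q * Q ^+ k) * fpoch Q Q l)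
     * (Q ^+ k.+1 * (1 - Q * Q ^+ l))).
  by ring.
by rewrite IH1 IH2 -def1 !exprS exprD exprS; ring.
Qed.

Lemma sum_sym (T : nat -> R) m :
  \sum_(k < m.*2.+1) T k = T m + \sum_(j < m) (T (m + j.+1)%N + T (m - j.+1)%N).
Proof.
rewrite -(big_mkord xpredT T) (big_cat_nat _ (n := m)) /=; last 2 first.
- by [].
- by rewrite -addnn ltnW // ltnS leq_addr.
rewrite [LHS]addrC big_split addrA /=; congr (_ + _); last first.
  rewrite big_rev_mkord subn0; apply: eq_bigr => j _.
  by congr T; have := ltn_ord j; lia.
rewrite -{1}(add0n m) big_addn -addnn -addnS addKn big_mkord big_ord_recl.
by congr (_ + _); apply: eq_bigr => j _; congr T; rewrite addnC.
Qed.

End Jacobi.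

(** * The limit of the finite triple product *)

Lemma eqX_divl n E f g : E \is a GRing.unit -> eqX n (E * f) (E * g) -> eqX n f g.
Proof.
move=> Eu Efg; rewrite -[f](mulKr Eu) -[g](mulKr Eu).
exact: eqXM.
Qed.

Lemma qpoch_unit a b : coef a 0 = 0 -> qpoch a b \is a GRing.unit.
Proof. by move=> a0; rewrite fps_unitE coef0_qpoch a0 subr0. Qed.

(** In the quotient formula all three finite products agree with (Q; Q)_oo modulo q^n, so the
    binomial is close to 1 / (Q; Q)_oo. *)
Lemma eqX_qbin n Q k l : coef Q 0 = 0 -> (n <= k)%N -> (n <= l)%N ->
  eqX n (qpoch Q Q * qbin Q (k + l) k) 1.
Proof.
move=> Q0 le_nk le_nl; apply: (eqX_divl (qpoch_unit Q Q0)); rewrite mulr1.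
have cvgE j : (n <= j)%N -> eqX n (fpoch Q Q j) (qpoch Q Q).
  by move=> le_nj; apply: (eqX_leq le_nj); apply: cvg_qpoch.
apply: eqX_trans (cvgE (k + l)%N (leq_trans le_nk (leq_addr _ _))).
rewrite -qbin_fpoch [X in eqX _ X _]mulrA [X in eqX _ X _]mulrC; apply: eqXM => //.
by apply: eqXM; apply: eqX_sym; apply: cvgE.
Qed.

Lemma triple_product x y : coef x 0 = 0 -> coef y 0 = 0 ->
  cvg (fun n => 1 + \sum_(j < n.*2)
                 (theta_term x (x * y) j.+1 + theta_term y (x * y) j.+1))
    (qpoch (- x) (x * y) * qpoch (- y) (x * y) * qpoch (x * y) (x * y)).
Proof.
move=> x0 y0 n; set Q := x * y.
have Q0 : coef Q 0 = 0 by rewrite coef0M x0 mul0r.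
have cvgQ a : eqX n (fpoch a Q n.*2) (qpoch a Q).
  by apply: (@eqX_leq _ n.*2); [rewrite -addnn leq_addr | apply: cvg_qpoch].
apply: eqX_sym; apply: (@eqX_trans _ _
  (fpoch (- y) Q n.*2 * fpoch (- x) Q n.*2 * qpoch Q Q)).
  apply: eqXM => //; rewrite mulrC.
  by apply: eqXM; apply: eqX_sym; apply: cvgQ.
rewrite finite_triple_product mulrC mulr_sumr.
have -> : 1 + \sum_(j < n.*2) (theta_term x Q j.+1 + theta_term y Q j.+1) =
    \sum_(k < (n.*2 + n.*2).+1) theta_bi x y n.*2 k.
  rewrite addnn sum_sym /theta_bi leqnn subnn /theta_term !expr0 mulr1.
  congr (_ + _); apply: eq_bigr => j _; rewrite leq_addr addKn ifN; last first.
    by have := ltn_ord j; lia.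
  by congr (_ + _); congr (_ ^+ _ * _ ^+ 'C(_, _)); have := ltn_ord j; lia.
apply: eqX_sum => k _; rewrite mulrA -[X in eqX _ _ X]mul1r.
have le_k : (k <= n.*2 + n.*2)%N by rewrite -ltnS.
(* For k between n and 3n the binomial has reached its limit. Otherwise k is at distance more than n
   from the centre 2n, and the theta term vanishes modulo q^n because it contains a power of x or y
   above n. *)
have [small|big] := boolP ((n <= k) && (n <= n.*2 + n.*2 - k))%N.
  have /andP[le_nk le_nl] := small; apply: eqXM => //.
  by rewrite -{1}(subnKC le_k); apply: eqX_qbin.
have T0 : eqX n (theta_bi x y n.*2 k) 0.
  by rewrite /theta_bi; case: leqP => ?; apply: eqX0_expM => //; lia.
apply: (@eqX_trans _ _ 0).
  rewrite -[X in eqX _ _ X](mulr0 (qpoch Q Q * qbin Q (n.*2 + n.*2) k)).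
  exact: eqXM.
by rewrite mul1r; apply: eqX_sym.
Qed.

Lemma cvgB u v f g : cvg u f -> cvg v g -> cvg (fun n => u n - v n) (f - g).
Proof.
by move=> uf vg n i lt_in; rewrite !fps_coefD !fps_coefN (uf n) ?(vg n).
Qed.

(** * Trisection of power series *)

Definition sgn_subst (f : fps) : fps := Fps (fun n => (-1) ^+ n * coef f n).

Fact sgn_subst_is_zmod_morphism : zmod_morphism sgn_subst.
Proof.
by move=> f g; apply: fpsP => n; rewrite /= mulrDr mulrN.
Qed.

Fact sgn_subst_is_monoid_morphism : monoid_morphism sgn_subst.
Proof.
split=> [|f g]; apply: fpsP => n.
  by case: n => [|n] /=; rewrite ?mulr0 ?mulr1.
rewrite [LHS]/= !fps_coefM big_distrr /=; apply: eq_bigr => i _.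
have le_in : (i <= n)%N by rewrite -ltnS.
by rewrite -{1}(subnKC le_in) exprD; ring.
Qed.

HB.instance Definition _ :=
  GRing.isZmodMorphism.Build fps fps sgn_subst sgn_subst_is_zmod_morphism.
HB.instance Definition _ :=
  GRing.isMonoidMorphism.Build fps fps sgn_subst sgn_subst_is_monoid_morphism.

Lemma sgn_substK : involutive sgn_subst.
Proof. by move=> f; apply: fpsP => n /=; rewrite mulrA -expr2 sqrr_sign mul1r. Qed.

Lemma sgn_subst_qX k : sgn_subst (q ^+ k) = (-1) ^+ k * q ^+ k.
Proof.
apply: fpsP => n; rewrite coef_signM /= coef_qX.
by case: eqP => [->|_] //; rewrite !mulr0.
Qed.

Lemma sgn_subst_q : sgn_subst q = - q.
Proof. by rewrite -[q]expr1 sgn_subst_qX !expr1 mulN1r. Qed.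

Lemma cvg_sgn_subst u f : cvg u f -> cvg (sgn_subst \o u) (sgn_subst f).
Proof. by move=> uf n i lt_in; rewrite /= (uf n). Qed.

Lemma comp_qX (f : fps) d n : (0 < d)%N ->
  coef (f (q ^+ d)) n = if (d %| n)%N then coef f (n %/ d) else 0.
Proof.
move=> d_gt0; rewrite /fps_comp /=.
have coefE k m : coef ((q ^+ d) ^+ k) m = (m == d * k)%N%:R.
  by rewrite -exprM coef_qX.
case: ifPn => [/dvdnP[m ->]|ndvd]; last first.
  rewrite big1 // => k _; rewrite coefE; case: eqP => [n_dk|]; last by rewrite mulr0.
  by case/negP: ndvd; rewrite n_dk dvdn_mulr.
rewrite mulnK //.
have lt_m : (m < (m * d).+1)%N by rewrite ltnS leq_pmulr.
rewrite (bigD1 (Ordinal lt_m)) //= coefE [(d * _)%N]mulnC eqxx mulr1.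
rewrite big1 ?addr0 // => k; rewrite -val_eqE coefE [(d * _)%N]mulnC eqn_pmul2r //=.
by rewrite eq_sym => /negbTE->; rewrite mulr0.
Qed.

Lemma comp_q (f : fps) : f q = f.
Proof.
by apply: fpsP => n; rewrite -[q]expr1 comp_qX // dvd1n divn1.
Qed.

Lemma comp_Nq (f : fps) : f (- q) = sgn_subst f.
Proof.
have coefE k m : coef ((- q) ^+ k) m = (-1) ^+ k * (m == k)%:R.
  by rewrite -[- q]mulN1r exprMn coef_signM coef_qX.
apply: fpsP => n; rewrite /= (bigD1 ord_max) //= coefE eqxx mulr1 mulrC.
rewrite big1 ?addr0 // => k; rewrite -val_eqE coefE eq_sym /= => /negbTE->.
by rewrite !mulr0.
Qed.

(** The components in f(q) = sum over r < 3 of q^r (tris r f)(q^3). *)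
Definition tris r (f : fps) : fps := Fps (fun n => coef f (3 * n + r)).

Fact tris_is_zmod_morphism r : zmod_morphism (tris r).
Proof. by move=> f g; apply: fpsP. Qed.

HB.instance Definition _ r :=
  GRing.isZmodMorphism.Build fps fps (tris r) (tris_is_zmod_morphism r).

Lemma tris_inj f g :
  tris 0 f = tris 0 g -> tris 1 f = tris 1 g -> tris 2 f = tris 2 g -> f = g.
Proof.
move=> eq0 eq1 eq2; apply: fpsP => n.
rewrite (divn_eq n 3) mulnC; have: (n %% 3 < 3)%N by rewrite ltn_mod.
case: (n %% 3)%N => [|[|[|//]]] _.
- by move/(congr1 (coef^~ (n %/ 3)%N)): eq0.
- by move/(congr1 (coef^~ (n %/ 3)%N)): eq1.
- by move/(congr1 (coef^~ (n %/ 3)%N)): eq2.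
Qed.

Lemma sum_ord3 (V : nmodType) (F : nat -> V) m :
  \sum_(i < 3 * m) F i =
  \sum_(k < m) (F (3 * k)%N + F (3 * k + 1)%N + F (3 * k + 2)%N).
Proof.
elim: m => [|m IHm]; first by rewrite muln0 !big_ord0.
rewrite mulnS [(3 + _)%N]addnC big_split_ord IHm [RHS]big_ord_recr /=; congr (_ + _).
by rewrite !big_ord_recr big_ord0 /= add0r addn0.
Qed.

(** The three product rules are multiplication in Z[[q^(1/3)]] in the basis 1, q^(1/3), q^(2/3) over
    Z[[q]]; a factor q appears when two residues add up to 3 or more. *)
Lemma tris0M f g : tris 0 (f * g) =
  tris 0 f * tris 0 g + q * (tris 1 f * tris 2 g + tris 2 f * tris 1 g).
Proof.
apply: fpsP => n; rewrite fps_coefD; set rest := coef (q * _) n.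
rewrite [LHS]fps_coefM addn0 big_ord_recr.
rewrite (sum_ord3 (fun i => coef f i * coef g (3 * n - i)%N)).
rewrite fps_coefM big_ord_recr addrAC /= !addn0; congr (_ + _); last first.
  by rewrite !subnn.
rewrite {}/rest coef_qM; case: n => [|n]; first by rewrite !big_ord0 addr0.
rewrite fps_coefD !fps_coefM -!big_split; apply: eq_bigr => k _ /=.
have le_kn : (k <= n)%N by rewrite -ltnS.
rewrite !addn0 addrA; congr (_ * coef g _ + _ * coef g _ + _ * coef g _); lia.
Qed.

Lemma tris1M f g : tris 1 (f * g) =
  tris 0 f * tris 1 g + tris 1 f * tris 0 g + q * (tris 2 f * tris 2 g).
Proof.
apply: fpsP => n; rewrite !fps_coefD; set rest := coef (q * _) n.
rewrite [LHS]fps_coefM !fps_coefM addn1 2![in LHS]big_ord_recr /=.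
rewrite (sum_ord3 (fun i => coef f i * coef g ((3 * n).+1 - i)%N)).
rewrite !(big_ord_recr n) /= !addn0 addn1 !subnn subSnn muln0.
rewrite !big_split /= {}/rest coef_qM; case: n => [|n].
  by rewrite !big_ord0; ring.
rewrite fps_coefM; set s1 := \sum_(i < n.+1) _; set s2 := \sum_(i < n.+1) _.
set s3 := \sum_(i < n.+1) _; set t1 := \sum_(i < n.+1) _.
set t2 := \sum_(i < n.+1) _; set t3 := \sum_(i < n.+1) _.
have -> : s1 = t1.
  by apply: eq_bigr => k _ /=; have := ltn_ord k => lt_k;
    congr (coef f _ * coef g _); lia.
have -> : s2 = t2.
  by apply: eq_bigr => k _ /=; have := ltn_ord k => lt_k;
    congr (coef f _ * coef g _); lia.
have -> : s3 = t3.
  by apply: eq_bigr => k _ /=; have := ltn_ord k => lt_k;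
    congr (coef f _ * coef g _); lia.
by rewrite addn1; ring.
Qed.

Lemma tris2M f g : tris 2 (f * g) =
  tris 0 f * tris 2 g + tris 1 f * tris 1 g + tris 2 f * tris 0 g.
Proof.
apply: fpsP => n; rewrite !fps_coefD !fps_coefM /=.
have -> : (3 * n + 2).+1 = (3 * n.+1)%N by lia.
rewrite (sum_ord3 (fun i => coef f i * coef g (3 * n + 2 - i)%N)) -!big_split.
apply: eq_bigr => k _ /=; have := ltn_ord k => lt_k.
by congr (coef f _ * coef g _ + coef f _ * coef g _ + coef f _ * coef g _); lia.
Qed.

Lemma tris_signM r k f : tris r ((-1) ^+ k * f) = (-1) ^+ k * tris r f.
Proof. by apply: fpsP => n; rewrite [RHS]coef_signM [LHS]coef_signM. Qed.

Lemma tris_sgn_subst r f :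
  tris r (sgn_subst f) = (-1) ^+ r * sgn_subst (tris r f).
Proof.
apply: fpsP => n; rewrite [RHS]coef_signM /= exprD [(-1) ^+ (3 * n)]exprM.
by rewrite (_ : (-1) ^+ 3 = -1 :> int) //; ring.
Qed.

Lemma tris_qX r s k : (r < 3)%N -> (s < 3)%N ->
  tris r (q ^+ (3 * k + s)) = if r == s then q ^+ k else 0.
Proof.
move=> lt_r lt_s; apply: fpsP => n; rewrite /= coef_qX.
case: (r =P s) => [->|ne_rs]; first by rewrite coef_qX eqn_add2r eqn_pmul2l.
by case: eqP => //; lia.
Qed.

Lemma cvg_tris r u f : (r < 3)%N -> cvg u f ->
  cvg (fun n => tris r (u (3 * n)%N)) (tris r f).
Proof. by move=> lt_r uf n i lt_in /=; rewrite (uf (3 * n)%N) //; lia. Qed.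

Definition expand3 (f : fps) : fps :=
  Fps (fun n => if (3 %| n)%N then coef f (n %/ 3) else 0).

Lemma comp_q3 (f : fps) : f (q ^+ 3) = expand3 f.
Proof. by apply: fpsP => n; rewrite comp_qX. Qed.

Lemma tris_expand3 r f : (r < 3)%N -> tris r (expand3 f) = if r == 0 then f else 0.
Proof.
move=> lt_r; apply: fpsP => n /=; rewrite dvdn_addr ?dvdn_mulr //.
case: r lt_r => [|r] lt_r; first by rewrite dvdn0 addn0 mulKn.
by rewrite gtnNdvd.
Qed.

Fact expand3_is_zmod_morphism : zmod_morphism expand3.
Proof.
move=> f g; apply: fpsP => n; rewrite fps_coefD fps_coefN /=.
by case: ifP => // _; rewrite subr0.
Qed.

Fact expand3_is_monoid_morphism : monoid_morphism expand3.
Proof.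
split=> [|f g].
  apply: fpsP => n /=.
  by case: ifP => [/dvdnP[m ->]|]; [rewrite mulnK // muln_eq0 orbF | case: n].
by apply: tris_inj; rewrite ?tris0M ?tris1M ?tris2M !tris_expand3 //=; ring.
Qed.

HB.instance Definition _ :=
  GRing.isZmodMorphism.Build fps fps expand3 expand3_is_zmod_morphism.
HB.instance Definition _ :=
  GRing.isMonoidMorphism.Build fps fps expand3 expand3_is_monoid_morphism.

Lemma expand3_qX k : expand3 (q ^+ k) = q ^+ (3 * k).
Proof.
apply: tris_inj; rewrite tris_expand3 // -[(3 * k)%N]addn0 tris_qX //.
Qed.

Lemma expand3_sgn_subst f : expand3 (sgn_subst f) = sgn_subst (expand3 f).
Proof.
apply: fpsP => n /=; case: ifP => [/dvdnP[m ->]|]; last by rewrite mulr0.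
by rewrite mulnK // mulnC exprM.
Qed.

Lemma cvg_expand3 u f : cvg u f -> cvg (expand3 \o u) (expand3 f).
Proof.
move=> uf n i lt_in /=; rewrite (uf n) //.
by apply: leq_ltn_trans lt_in; apply: leq_div.
Qed.

(* The product of f(q), f(wq), f(w^2 q), w a primitive cube root of unity, as  *)
(* a series in q^3, with q^3 then replaced by q.                               *)
Definition norm3 f := tris 0 f ^+ 3 + q * tris 1 f ^+ 3 + q ^+ 2 * tris 2 f ^+ 3
  - 3%:R * q * (tris 0 f * tris 1 f * tris 2 f).

Lemma norm3M f g : norm3 (f * g) = norm3 f * norm3 g.
Proof. by rewrite /norm3 tris0M tris1M tris2M; ring. Qed.

Lemma cvg_norm3 u f : cvg u f -> cvg (fun n => norm3 (u (3 * n)%N)) (norm3 f).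
Proof.
move=> uf; have cvg_r r lt_r := @cvg_tris r u f lt_r uf.
apply: cvgB; last first.
  by apply: cvgM; [apply: cvg_cst | do 2?apply: cvgM; apply: cvg_r].
apply: cvgD; last by apply: (cvgM (cvg_cst _)); apply: cvgX; apply: cvg_r.
apply: cvgD; first by apply: cvgX; apply: cvg_r.
by apply: (cvgM (cvg_cst _)); apply: cvgX; apply: cvg_r.
Qed.

Lemma norm3_sgn_subst f : norm3 (sgn_subst f) = sgn_subst (norm3 f).
Proof.
rewrite /norm3 !tris_sgn_subst !(rmorph_nat, rmorphN, rmorphD, rmorphM, rmorphXn) /=.
by rewrite sgn_subst_q; ring.
Qed.

(** * The norm of the infinite products *)

Lemma tris1 r : (r < 3)%N -> tris r 1 = (r == 0)%:R.
Proof.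
by move=> lt_r; rewrite -[1](expr0 q) -[0%N]/(3 * 0 + 0)%N tris_qX //; case: eqP.
Qed.

(** For m prime to 3, the conjugates 1 - c w^j q^m multiply to 1 - c^3 q^(3m), and replacing q^3 by
    q gives the factor back because the sign c satisfies c^3 = c. *)
Lemma norm3_factor b k s : (0 < s < 3)%N ->
  norm3 (1 - (-1) ^+ b * q ^+ (3 * k + s)) = 1 - (-1) ^+ b * q ^+ (3 * k + s).
Proof.
move=> /andP[s_gt0 lt_s3]; have sign3 : ((-1) ^+ b) ^+ 3 = (-1) ^+ b :> fps.
  by rewrite exprS sqrr_sign mulr1.
rewrite /norm3 !raddfB /= !tris_signM !tris1 // !tris_qX //.
case: s s_gt0 lt_s3 => [|[|[|//]]] //= _ _; rewrite [(3 * k)%N]mulnC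
  exprD exprM -[X in _ = 1 - X * _]sign3; move: ((-1) ^+ b) => c; ring.
Qed.

(** Here the factor is a series in q^3, so it equals its three conjugates and its norm is a cube. *)
Lemma norm3_factor0 b k :
  norm3 (1 - (-1) ^+ b * q ^+ (3 * k)) = (1 - (-1) ^+ b * q ^+ k) ^+ 3.
Proof.
rewrite -[(3 * k)%N]addn0 /norm3 !raddfB /= !tris_signM !tris1 // !tris_qX //=.
by ring.
Qed.

(** Factors with exponent prime to 3 are their own norm; the one with exponent 3k is replaced by the
    cube of the one with exponent k. The product over multiples of 3 on the left restores the
    missing factors. *)
Lemma norm3_fpoch b n :
  norm3 (fpoch ((-1) ^+ b * q) q (3 * n)) * fpoch ((-1) ^+ b * q ^+ 3) (q ^+ 3) n
  = fpoch ((-1) ^+ b * q) q (3 * n) * fpoch ((-1) ^+ b * q) q n ^+ 3.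
Proof.
have fS m : fpoch ((-1) ^+ b * q) q m.+1 =
    fpoch ((-1) ^+ b * q) q m * (1 - (-1) ^+ b * q ^+ m.+1).
  by rewrite fpochS -mulrA -exprS.
have f3S m : fpoch ((-1) ^+ b * q ^+ 3) (q ^+ 3) m.+1 =
    fpoch ((-1) ^+ b * q ^+ 3) (q ^+ 3) m * (1 - (-1) ^+ b * q ^+ (3 * m.+1)).
  by rewrite fpochS -mulrA -exprS -exprM.
elim: n => [|n IHn].
  by rewrite /fpoch muln0 !big_ord0 /norm3 !tris1 //=; ring.
have -> : (3 * n.+1 = (3 * n).+3)%N by lia.
rewrite f3S !fS !norm3M.
have -> : (3 * n).+1 = (3 * n + 1)%N by rewrite addn1.
have -> : (3 * n + 1).+1 = (3 * n + 2)%N by rewrite addn1 addn2.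
have -> : (3 * n + 2).+1 = (3 * n.+1)%N by lia.
rewrite !norm3_factor // norm3_factor0.
move: IHn; set F := fpoch _ _ (3 * n); set F3 := fpoch _ (q ^+ 3) n => IHn.
set u1 := 1 - _; set u2 := 1 - _; set v := 1 - _; set u3 := 1 - _.
transitivity (norm3 F * F3 * (u1 * u2 * u3 * v ^+ 3)); first by ring.
by rewrite IHn; ring.
Qed.

Lemma expand3_q : expand3 q = q ^+ 3.
Proof. exact: (expand3_qX 1). Qed.

Lemma norm3_qpoch b :
  norm3 (qpoch ((-1) ^+ b * q) q) * expand3 (qpoch ((-1) ^+ b * q) q) =
  qpoch ((-1) ^+ b * q) q ^+ 4.
Proof.
set F := qpoch _ q.
have cvgF : cvg (fpoch ((-1) ^+ b * q) q) F by apply: cvg_qpoch.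
have cvgF3 : cvg (fun n => fpoch ((-1) ^+ b * q) q (3 * n)) F.
  by apply: (cvg_sub cvgF) => n; rewrite leq_pmull.
rewrite exprS; apply: cvg_unique (cvgM cvgF3 (cvgX 3 cvgF)).
apply: (eq_cvg (norm3_fpoch b)); apply: cvgM; first exact: cvg_norm3.
apply: eq_cvg (cvg_expand3 cvgF) => n /=; rewrite rmorph_prod /=.
apply: eq_bigr => i _; rewrite rmorphB rmorph1 !rmorphM rmorph_sign.
by rewrite rmorphXn /= expand3_q.
Qed.

(** * Theta series *)

Definition theta n : fps := 1 + (\sum_(j < n) q ^+ (j.+1 ^ 2)) *+ 2.

Lemma coef_phi n : coef phi n = (0 == n)%:R + (\sum_(j < n) (j.+1 ^ 2 == n)%N%:R) *+ 2.
Proof.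
rewrite /= -sum1dep_card big_mkcond -natz natr_sum /=.
pose T k : int := (((k%:Z - n%:Z) ^+ 2 == n%:Z) : nat)%:R.
rewrite (eq_bigr (fun j : 'I_n.*2.+1 => T j)); last by move=> j _; rewrite /T; case: eqP.
rewrite sum_sym /T subrr expr0n -sumrMnl; congr (_ + _); apply: eq_bigr => j _.
have sqrE k : ((k%:Z ^+ 2 == n%:Z) = (k ^ 2 == n)%N) by rewrite expr2 -PoszM mulnn eqz_nat.
rewrite PoszD addrAC subrr add0r sqrE -subzn // addrAC subrr add0r sqrrN sqrE.
by rewrite mulr2n.
Qed.

Lemma cvg_theta : cvg theta phi.
Proof.
move=> n i lt_in; rewrite coef_phi fps_coefD coef_fpsZn fps_coef_sum eq_sym.
congr (_ + _ *+ 2); under eq_bigr => j _ do rewrite coef_qX eq_sym.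
rewrite -!(big_mkord xpredT (fun j => (j.+1 ^ 2 == i)%N%:R : int)).
rewrite (big_cat_nat _ (n := i)) //=; last exact: ltnW.
rewrite [X in _ + X = _]big_nat_cond [X in _ + X = _]big1 ?addr0 // => j.
case/andP=> /andP[le_ij _] _.
by case: eqP => //; nia.
Qed.

Lemma bin2E j : (j + 'C(j, 2).*2 = j ^ 2)%N.
Proof. by elim: j => // j IHj; rewrite binS bin1; lia. Qed.

Lemma theta_term_gauss j : theta_term (- q) (q ^+ 2) j = sgn_subst (q ^+ (j ^ 2)).
Proof.
rewrite /theta_term -exprM mul2n -[- q]mulN1r exprMn -mulrA -exprD bin2E.
rewrite sgn_subst_qX; congr (_ * _).
by rewrite -[RHS]signr_odd oddX /= signr_odd.
Qed.

(** The triple product at x = y = -q. *)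
Lemma gauss_phi :
  sgn_subst phi = qpoch q (q ^+ 2) ^+ 2 * qpoch (q ^+ 2) (q ^+ 2).
Proof.
have q0 : coef (- q) 0 = 0 by [].
have := triple_product q0 q0; rewrite mulrNN opprK -!expr2.
apply: cvg_unique; have := cvg_sub (cvg_sgn_subst cvg_theta) (fun n => leq_addr n n).
apply: eq_cvg => n /=; rewrite addnn rmorphD rmorph1 rmorphMn rmorph_sum /=.
congr (_ + _); rewrite -sumrMnl; apply: eq_bigr => j _.
by rewrite -theta_term_gauss.
Qed.

Lemma coef_qX0 k : (0 < k)%N -> coef (q ^+ k) 0 = 0.
Proof. by move=> k_gt0; rewrite coef_qX; case: k k_gt0. Qed.

(** Gauss's phi(-q) = (q; q)_oo / (-q; q)_oo, obtained from the previous product by Euler's identity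
    (q; q^2)_oo (-q; q)_oo = 1. *)
Lemma gauss_quotient : sgn_subst phi * qpoch (- q) q = qpoch q q.
Proof.
have E2 : qpoch (q ^+ 2) (q ^+ 2) = qpoch q q * qpoch (- q) q.
  apply: cvg_unique (cvg_qpoch _ (coef_qX0 (isT : 0 < 2)%N)) _.
  apply: eq_cvg (cvgM (cvg_qpoch q _) (cvg_qpoch (- q) _)) => // n.
  rewrite /fpoch -big_split; apply: eq_bigr => i _ /=.
  by rewrite exprAC; ring.
have E1 : qpoch q q = qpoch q (q ^+ 2) * qpoch (q ^+ 2) (q ^+ 2).
  rewrite (@qpoch_split 2 q q) // !big_ord_recl big_ord0 /= mulr1.
  by rewrite expr0 mulr1 -expr2.
have U : qpoch q q \is a GRing.unit by apply: qpoch_unit.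
have euler : qpoch q (q ^+ 2) * qpoch (- q) q = 1.
  by apply: (mulrI U); rewrite mulr1 {2}E1 E2; ring.
rewrite gauss_phi expr2 -!mulrA [qpoch (q ^+ 2) _ * _]mulrC.
by rewrite !mulrA -[_ * _ * qpoch (- q) q]mulrA euler mulr1 -E1.
Qed.

(** * The 3-dissection of phi *)

Definition omega n : fps :=
  1 + \sum_(k < n) (q ^+ (3 * k ^ 2 + 4 * k + 1) + q ^+ (3 * k ^ 2 + 8 * k + 5)).

(** Squares of multiples of 3 give phi(q^9). The others are 1, (3k+2)^2 = 3 (3k^2 + 4k + 1) + 1 and
    (3k+4)^2 = 3 (3k^2 + 8k + 5) + 1, which explains the exponents in [omega]. *)
Lemma theta_trisect n : theta (3 * n + 1) =
  expand3 (expand3 (theta n)) + (q * expand3 (omega n)) *+ 2.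
Proof.
rewrite /theta /omega addn1 big_ord_recl.
under eq_bigr => j _ do rewrite lift0.
rewrite (sum_ord3 (fun j => q ^+ (j.+2 ^ 2))) /=.
rewrite !(rmorphD, rmorph1, rmorphMn, rmorph_sum) /= -addrA -mulrnDl; congr (_ + _ *+ 2).
rewrite mulrDr mulr1 mulr_sumr addrCA -big_split /= -[(1 ^ 2)%N]/1%N expr1; congr (_ + _).
apply: eq_bigr => k _; rewrite rmorphD /= !expand3_qX mulrDr -!exprS.
rewrite [X in X + _]addrC -addrA; congr (q ^+ _ + (q ^+ _ + q ^+ _)); lia.
Qed.

Lemma cvg_theta_trisect r : (r < 3)%N ->
  cvg (fun n => tris r (theta (3 * n + 1))) (tris r phi).
Proof.
by move=> lt_r; apply: (cvg_tris lt_r (cvg_sub cvg_theta (leq_addr 1))).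
Qed.

Lemma tris_q r : (r < 3)%N -> tris r q = (r == 1%N)%:R.
Proof. by move=> lt_r; rewrite -[q]/(q ^+ (3 * 0 + 1)) tris_qX //; case: eqP. Qed.

Lemma tris0_phi : tris 0 phi = expand3 phi.
Proof.
apply: cvg_unique (cvg_theta_trisect (isT : 0 < 3)%N) _.
apply: eq_cvg (cvg_expand3 cvg_theta) => n.
rewrite theta_trisect raddfD raddfMn /= tris0M !tris_expand3 // !tris_q //=.
by ring.
Qed.

Lemma tris2_phi : tris 2 phi = 0.
Proof.
apply: cvg_unique (cvg_theta_trisect (isT : 2 < 3)%N) _.
apply: eq_cvg (cvg_cst 0) => n.
rewrite theta_trisect raddfD raddfMn /= tris2M !tris_expand3 // !tris_q //=.
by ring.
Qed.

Lemma cvg_omega : cvg (fun n => omega n *+ 2) (tris 1 phi).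
Proof.
apply: eq_cvg (cvg_theta_trisect (isT : 1 < 3)%N) => n.
rewrite theta_trisect raddfD raddfMn /= tris1M !tris_expand3 // !tris_q //=.
by ring.
Qed.

(** Splitting every product modulo 6 puts B in the shape of the triple product at x = -q, y =
    -q^5. *)
Lemma B_product :
  B = qpoch q (q ^+ 6) * qpoch (q ^+ 5) (q ^+ 6) * qpoch (q ^+ 6) (q ^+ 6).
Proof.
have unitq k b : (0 < k)%N -> qpoch (q ^+ k) b \is a GRing.unit.
  by move=> k_gt0; apply: qpoch_unit; apply: coef_qX0.
have split d k b : (0 < d)%N -> (0 < k)%N ->
    qpoch b (q ^+ k) = \prod_(r < d) qpoch (b * q ^+ (k * r)) (q ^+ (k * d)).
  move=> d_gt0 k_gt0; rewrite (@qpoch_split d) ?coef_qX0 //.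
  by apply: eq_bigr => r _; rewrite -!exprM.
set d := qpoch (q ^+ 2) (q ^+ 2) * qpoch (q ^+ 3) (q ^+ 3).
have Ud : d \is a GRing.unit by rewrite unitrM !unitq.
apply: (canLR (mulrK Ud)).
have -> : qpoch q q = qpoch q (q ^+ 2) * qpoch (q ^+ 2) (q ^+ 2).
  by rewrite (split 2%N 1%N q) // !big_ord_recl big_ord0 /= mulr1 expr0 mulr1.
have -> : qpoch q (q ^+ 2) =
    qpoch q (q ^+ 6) * (qpoch (q ^+ 3) (q ^+ 6) * qpoch (q ^+ 5) (q ^+ 6)).
  rewrite (split 3%N 2%N q) // !big_ord_recl big_ord0 /= mulr1 expr0 mulr1.
  by rewrite -!exprS.
rewrite {Ud}/d (split 2%N 3%N (q ^+ 3)) // !big_ord_recl big_ord0 /= mulr1 expr0 mulr1.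
by rewrite -exprD; do 5!move: (qpoch _ _) => ?; ring.
Qed.

Lemma theta_term_omega j :
  theta_term (- q) (q ^+ 6) j.+1 = sgn_subst (q ^+ (3 * j ^ 2 + 4 * j + 1)).
Proof.
rewrite /theta_term -exprM -[- q]mulN1r exprMn -mulrA -exprD sgn_subst_qX.
congr (_ * q ^+ _); last by have := bin2E j.+1; lia.
by rewrite -[LHS]signr_odd -[RHS]signr_odd !oddD !oddM /=; case: (odd j).
Qed.

Lemma theta_term_omega5 j :
  theta_term (- q ^+ 5) (q ^+ 6) j.+1 = sgn_subst (q ^+ (3 * j ^ 2 + 8 * j + 5)).
Proof.
rewrite /theta_term -[- _]mulN1r exprMn -!exprM -mulrA -exprD sgn_subst_qX.
congr (_ * q ^+ _); last by have := bin2E j.+1; lia.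
by rewrite -[LHS]signr_odd -[RHS]signr_odd !oddD !oddM /=; case: (odd j).
Qed.

Lemma cvg_omega_B : cvg (sgn_subst \o (omega \o double)) B.
Proof.
have q0 : coef (- q) 0 = 0 by [].
have q50 : coef (- q ^+ 5) 0 = 0 by rewrite fps_coefN coef_qX0.
have := triple_product q0 q50; rewrite mulrNN !opprK -exprS -B_product.
apply: eq_cvg => n; rewrite /= rmorphD rmorph1 rmorph_sum; congr (_ + _).
by apply: eq_bigr => j _; rewrite rmorphD theta_term_omega theta_term_omega5.
Qed.

Lemma tris1_phi : tris 1 phi = sgn_subst B *+ 2.
Proof.
apply: (cvg_unique (cvg_sub cvg_omega (fun n => leq_addr n n))).
have := cvg_sgn_subst cvg_omega_B => cvgB.
apply: eq_cvg (cvgD cvgB cvgB) => n.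
by rewrite /= sgn_substK addnn mulr2n.
Qed.

(** * The generating function of overpartitions *)

Lemma coef_qXM k f n :
  coef (q ^+ k * f) n = if (k <= n)%N then coef f (n - k) else 0.
Proof.
elim: k n => [|k IHk] n; first by rewrite expr0 mul1r subn0.
by rewrite exprS -mulrA coef_qM; case: n => // n; rewrite IHk.
Qed.

Definition positive_parts : pred (seq (nat * bool)) := all (fun x => 0 < x.1)%N.

Definition bounded_parts n : seq (seq (nat * bool)) :=
  [seq parts t | t : bounded_seq n].

Lemma parts_inj n : injective (@parts n).
Proof.
move=> s t eq_st; apply: val_inj; apply: (inj_map _ eq_st).
by move=> [i b] [j c] [/val_inj-> ->].
Qed.

Lemma bounded_parts_uniq n : uniq (bounded_parts n).
Proof. by rewrite map_inj_uniq ?enum_uniq //; apply: parts_inj. Qed.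

Lemma weight_cons x s : weight (x :: s) = (x.1 + weight s)%N.
Proof. exact: big_cons. Qed.

Lemma size_le_weight s : positive_parts s -> (size s <= weight s)%N.
Proof.
elim: s => // x s IHs /= /andP[x_gt0 /IHs le_s].
by rewrite weight_cons -add1n leq_add.
Qed.

Lemma part_le_weight s x : x \in s -> (x.1 <= weight s)%N.
Proof. by move=> s_x; rewrite /weight (big_rem x) //= leq_addr. Qed.

Lemma mem_bounded_parts n s :
  positive_parts s -> (weight s <= n)%N -> s \in bounded_parts n.
Proof.
move=> s_pos le_sn; pose t := [seq (inord x.1 : 'I_n.+1, x.2) | x <- s].
have le_t : (size t <= n)%N by rewrite size_map (leq_trans (size_le_weight _)).
apply/mapP; exists (Bseq le_t); first by rewrite mem_enum.
rewrite /parts /= -map_comp -[LHS]map_id; apply/eq_in_map => -[k b] s_x /=.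
by rewrite inordK // ltnS (leq_trans (part_le_weight s_x)).
Qed.

Definition part_count (A : pred (seq (nat * bool))) N n :=
  count (fun s => A s && (weight s == n)) (bounded_parts N).

(** Positive parts of total n number at most n and are each at most n, so any bound N >= n catches
    every sequence, and the count can be made on any exact enumeration. *)
Lemma part_count_perm (A : pred (seq (nat * bool))) n N l :
    {subset A <= positive_parts} -> (n <= N)%N -> uniq l ->
    (forall s, (s \in l) = A s && (weight s == n)) ->
  part_count A N n = size l.
Proof.
move=> Apos le_nN l_uniq mem_l; rewrite /part_count -size_filter; apply: perm_size.
apply: uniq_perm => // [|s]; first exact: filter_uniq (bounded_parts_uniq N).
rewrite mem_filter mem_l; apply: andb_idr => /andP[As /eqP w_s].
by rewrite mem_bounded_parts ?w_s //; apply: Apos.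
Qed.

Definition part_list A n :=
  [seq s <- bounded_parts n | A s && (weight s == n)].

Lemma mem_part_list (A : pred (seq (nat * bool))) n s : {subset A <= positive_parts} ->
  (s \in part_list A n) = A s && (weight s == n).
Proof.
move=> Apos; rewrite mem_filter; apply: andb_idr => /andP[As /eqP w_s].
by rewrite mem_bounded_parts ?w_s //; apply: Apos.
Qed.

Lemma part_count_widen (A : pred (seq (nat * bool))) n N :
  {subset A <= positive_parts} -> (n <= N)%N -> part_count A N n = part_count A n n.
Proof.
move=> Apos le_nN; rewrite (@part_count_perm A n N (part_list A n)) ?size_filter //.
  exact: filter_uniq (bounded_parts_uniq n).
by move=> s; apply: mem_part_list.
Qed.

Definition part_gf A : fps := Fps (fun n => (part_count A n n)%:Z).

Lemma part_gf_coef (A : pred (seq (nat * bool))) n l :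
    {subset A <= positive_parts} -> uniq l ->
    (forall s, (s \in l) = A s && (weight s == n)) ->
  coef (part_gf A) n = (size l)%:Z.
Proof. by move=> Apos Ul mem_l; rewrite /= (part_count_perm Apos _ Ul mem_l). Qed.

Lemma part_list_size (A : pred (seq (nat * bool))) n :
  coef (part_gf A) n = (size (part_list A n))%:Z.
Proof. by rewrite size_filter. Qed.

Lemma eq_part_gf (A A' : pred (seq (nat * bool))) : A =1 A' -> part_gf A = part_gf A'.
Proof.
move=> eqA; apply: fpsP => n /=; congr (_%:Z).
by apply: eq_count => s; rewrite eqA.
Qed.

Lemma part_gfU (A A' : pred (seq (nat * bool))) : (forall s, ~~ (A s && A' s)) ->
  part_gf (fun s => A s || A' s) = part_gf A + part_gf A'.
Proof.
move=> disj; apply: fpsP => n; rewrite fps_coefD /= -PoszD; congr (_%:Z).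
rewrite /part_count -count_predUI [X in (_ + X)%N](_ : _ = 0%N) ?addn0.
  by apply: eq_count => s; rewrite /= andb_orl.
rewrite (eq_count (a2 := pred0)) ?count_pred0 // => s /=.
by apply/negP => /andP[/andP[As _] /andP[As' _]]; case/andP: (disj s).
Qed.

Definition cons_pred (x : nat * bool) (A : pred (seq (nat * bool))) :=
  fun s => if s is y :: s' then (y == x) && A s' else false.

Lemma part_gf_cons (x : nat * bool) (A : pred (seq (nat * bool))) : (0 < x.1)%N ->
  {subset A <= positive_parts} -> part_gf (cons_pred x A) = q ^+ x.1 * part_gf A.
Proof.
move=> x_gt0 Apos; apply: fpsP => n; rewrite coef_qXM part_list_size.
have consPos : {subset cons_pred x A <= positive_parts}.
  by move=> [|y s] //= /andP[/eqP-> As]; rewrite unfold_in /= x_gt0; apply: Apos.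
case: leqP => [le_xn|lt_nx].
  rewrite (part_list_size A) -[in RHS](size_map (cons x)); congr (_%:Z); apply: perm_size.
  apply: uniq_perm.
  - exact: filter_uniq (bounded_parts_uniq n).
  - by rewrite map_inj_uniq ?filter_uniq ?bounded_parts_uniq // => s t [].
  move=> s; rewrite mem_part_list //; apply/idP/mapP => [|[t]].
    case: s => //= y s /andP[/andP[/eqP-> As] /eqP w_s].
    by exists s; rewrite // mem_part_list // As -w_s weight_cons addKn eqxx.
  rewrite mem_part_list // => /andP[At /eqP w_t] -> /=.
  by rewrite eqxx At weight_cons w_t subnKC /=.
rewrite /part_list (eq_filter (a2 := pred0)) ?filter_pred0 // => -[|y s] //=.
apply/negP => /andP[/andP[/eqP-> _]]; rewrite weight_cons => /eqP w_s.
by rewrite -w_s ltnNge leq_addr in lt_nx.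
Qed.

(** * Recursion on the largest part *)

Definition overpartition_le k : pred (seq (nat * bool)) :=
  fun s => overpartition s && (if s is x :: _ then x.1 <= k else true)%N.

(** The admissible tails behind a part k: an overlined k is excluded, since it would no longer be a
    first occurrence. *)
Definition overpartition_after k : pred (seq (nat * bool)) :=
  fun s => overpartition_le k s && (if s is x :: _ then x != (k, true) else true).

Lemma overpartition_cons k b s : (0 < k)%N ->
  overpartition ((k, b) :: s) = overpartition_after k s.
Proof.
rewrite /overpartition_after /overpartition_le /overpartition /= => -> /=.
case: s => //= -[j c] s /=; rewrite xpair_eqE; case: (all _ s); rewrite ?andbF //= !andbT.
case: (path _ _ s); rewrite ?andbF //= !andbT.
by case: (0 < j)%N => //=; case: ltngtP; case: c.
Qed.

Lemma overpartition_leS k : overpartition_le k.+1 =1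
  fun s => [|| overpartition_le k s,
     cons_pred (k.+1, true) (overpartition_after k.+1) s
     | cons_pred (k.+1, false) (overpartition_after k.+1) s].
Proof.
case=> [|[j b] s] //=; rewrite {1 2}/overpartition_le ?xpair_eqE.
case: (ltngtP j k.+1) => [lt_jk|lt_kj|->].
- by rewrite -ltnS lt_jk orbF.
- by rewrite leqNgt (ltn_trans _ lt_kj) // andbF.
by rewrite ltnn !andbT overpartition_cons //; case: b; rewrite ?andbF ?orbF.
Qed.

Lemma overpartition_afterS k : overpartition_after k.+1 =1
  fun s => overpartition_le k s
     || cons_pred (k.+1, false) (overpartition_after k.+1) s.
Proof.
case=> [|[j b] s] //=; rewrite {1}/overpartition_after {1 2}/overpartition_le ?xpair_eqE.
case: (ltngtP j k.+1) => [lt_jk|lt_kj|->].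
- by rewrite -ltnS lt_jk orbF !andbT.
- by rewrite leqNgt (ltn_trans _ lt_kj) // andbF.
by rewrite ltnn !andbT overpartition_cons //; case: b; rewrite ?andbF ?andbT ?orbF.
Qed.

Lemma overpartition_pos : {subset overpartition <= positive_parts}.
Proof. by move=> s /andP[]. Qed.

Lemma overpartition_after_pos k : {subset overpartition_after k <= positive_parts}.
Proof. by move=> s /andP[/andP[/overpartition_pos]]. Qed.

(** With S, S' for largest part at most k, k + 1 and R for the tails behind k + 1, removing the
    first part gives R = S + q^(k+1) R and S' = S + 2 q^(k+1) R. Eliminating R gives S' (1 -
    q^(k+1)) = S (1 + q^(k+1)). *)
Lemma part_gf_le k :
  part_gf (overpartition_le k) * fpoch q q k = fpoch (- q) q k.
Proof.
elim: k => [|k IHk].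
  rewrite /fpoch !big_ord0 mulr1; apply: fpsP => n.
  rewrite (@part_gf_coef _ _ (if n == 0%N then [:: [::]] else [::])).
  - by case: n.
  - by move=> s /andP[/overpartition_pos].
  - by case: ifP.
  case=> [|[j b] s]; rewrite /overpartition_le /=.
    by rewrite /weight big_nil eq_sym; case: eqP; rewrite ?inE.
  rewrite leqn0 /overpartition /=; case: posnP => _ /=; rewrite ?andbF /=;
    by case: ifP.
set S := part_gf (overpartition_le k) in IHk *.
set S' := part_gf (overpartition_le k.+1).
set R := part_gf (overpartition_after k.+1).
have disj b s : ~~ (overpartition_le k s && cons_pred (k.+1, b) (overpartition_after k.+1) s).
  case: s => [|[j c] s] //=; rewrite /overpartition_le xpair_eqE.
  by case: eqP => [->|]; rewrite ?ltnn ?andbF.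
have defR : R = S + q ^+ k.+1 * R.
  rewrite {1}/R (eq_part_gf (overpartition_afterS k)) part_gfU //.
  by rewrite part_gf_cons //; apply: overpartition_after_pos.
have defS : S' = S + (q ^+ k.+1 * R + q ^+ k.+1 * R).
  rewrite /S' (eq_part_gf (overpartition_leS k)) part_gfU; last first.
    by move=> s; rewrite /= andb_orr negb_or !disj.
  rewrite part_gfU ?part_gf_cons //; try exact: overpartition_after_pos.
  by case=> [|[j b] s] //=; rewrite !xpair_eqE; case: b; rewrite ?andbF.
have SR : R * (1 - q ^+ k.+1) = S by rewrite mulrBr mulr1 {1}defR; ring.
rewrite !fpochS -IHk defS -SR mulNr opprK -!exprS; ring.
Qed.

Lemma cvg_part_gf_le : cvg (fun k => part_gf (overpartition_le k)) (part_gf overpartition).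
Proof.
move=> k n lt_nk /=; congr (_%:Z); apply: eq_count => -[|x s] //=.
rewrite /overpartition_le; case: eqP => [w_n|]; rewrite ?andbF ?andbT //.
rewrite (_ : (x.1 <= k)%N) ?andbT //; apply: leq_trans (ltnW lt_nk).
by rewrite -w_n weight_cons leq_addr.
Qed.

Lemma overpartition_gf : part_gf overpartition * qpoch q q = qpoch (- q) q.
Proof.
apply: cvg_unique (cvg_qpoch (- q) (erefl : coef q 0 = 0)).
apply: (eq_cvg part_gf_le); apply: cvgM cvg_part_gf_le _.
exact: cvg_qpoch.
Qed.

Lemma eqX_part_gf n :
  eqX n.+1 (\sum_(t : bounded_seq n | overpartition (parts t)) q ^+ weight (parts t))
    (part_gf overpartition).
Proof.
move=> i; rewrite ltnS => le_in; rewrite fps_coef_sum /=.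
rewrite -(part_count_widen overpartition_pos le_in) /part_count -sum1_count.
rewrite big_map big_enum_cond /= -natz natr_sum [RHS]big_mkcondr /=.
by apply: eq_bigr => t _; rewrite coef_qX eq_sym; case: eqP.
Qed.

Lemma p3bar_gf : Fps (fun n => (p3bar n)%:Z) = part_gf overpartition ^+ 3.
Proof.
apply: fpsP => n; have /(_ n (ltnSn n))<- := eqX_exp 3 (@eqX_part_gf n).
have -> : (\sum_(t : bounded_seq n | overpartition (parts t))
             q ^+ weight (parts t)) ^+ 3 =
    \sum_(t : bounded_seq n * bounded_seq n * bounded_seq n |
      overpartition (parts t.1.1) && overpartition (parts t.1.2)
        && overpartition (parts t.2))
      q ^+ (weight (parts t.1.1) + weight (parts t.1.2) + weight (parts t.2)).
  rewrite 2!exprSr expr1 big_distrlr pair_big big_distrlr pair_big /=.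
  by apply: eq_bigr => t _; rewrite !exprD.
rewrite fps_coef_sum; under [RHS]eq_bigr => t _ do rewrite coef_qX eq_sym.
rewrite [LHS]/= /p3bar -sum1dep_card -natz natr_sum big_mkcond [RHS]big_mkcond /=.
apply: eq_bigr => -[[r s] t] _ /=; rewrite !andbA [LHS]if_and.
by case: ifP => // _; case: eqP.
Qed.

(** * The components of the cube *)

Lemma overpartition_gf_phi : sgn_subst (part_gf overpartition) * phi = 1.
Proof.
have U : qpoch (- q) q \is a GRing.unit by apply: qpoch_unit.
have P1 : part_gf overpartition * sgn_subst phi = 1.
  by apply: (mulIr U); rewrite mul1r -mulrA gauss_quotient overpartition_gf.
by rewrite -[phi]sgn_substK -rmorphM P1 rmorph1.
Qed.

(** phi(-q) is a quotient of two products, and [norm3_qpoch] applies to both, with the two choices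
    of sign; multiplicativity then gives phi(-q), and q -> -q commutes with the norm. *)
Lemma norm3_phi : norm3 phi * expand3 phi = phi ^+ 4.
Proof.
rewrite -[phi]sgn_substK expand3_sgn_subst norm3_sgn_subst -rmorphM -rmorphXn.
congr (sgn_subst _); move: (sgn_subst phi) gauss_quotient => f fME.
have := norm3_qpoch 0; have := norm3_qpoch 1; rewrite expr0 expr1 mul1r mulN1r.
rewrite -fME norm3M rmorphM /= exprMn; set M := qpoch _ q => NM NfM.
have U : M ^+ 4 \is a GRing.unit by rewrite unitrX // qpoch_unit.
by apply: (mulIr U); rewrite -NfM -NM; ring.
Qed.

Lemma phi_unit : phi \is a GRing.unit.
Proof. by rewrite fps_unitE coef_phi big_ord0. Qed.

Lemma expand3_phi_unit : expand3 phi \is a GRing.unit.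
Proof. exact: phi_unit. Qed.

Lemma eqmod_addMn (m : nat) (f g h : fps) : f = g + h *+ m -> f = g %[mod m%:Z].
Proof.
move=> -> n; rewrite fps_coefD coef_fpsZn -mulr_natr natz addrC.
exact: modzMDl.
Qed.

Section Dissection.

Let a := expand3 phi.
Let b := sgn_subst B.
Let D := a ^+ 3 + 8%:R * q * b ^+ 3.
Let p := sgn_subst (part_gf overpartition).

Lemma normE : D * a = phi ^+ 4.
Proof.
rewrite -norm3_phi /norm3 tris0_phi tris1_phi tris2_phi -/a -/b /D; ring.
Qed.

Lemma D_unit : D \is a GRing.unit.
Proof.
have := unitrX 4 phi_unit; rewrite -normE unitrM.
by case/andP.
Qed.

Lemma tris_p : [/\ tris 0 p = a ^+ 2 / D, tris 1 p = - (2%:R * a * b) / D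
  & tris 2 p = 4%:R * b ^+ 2 / D].
Proof.
have := congr1 (tris 0) overpartition_gf_phi.
have := congr1 (tris 1) overpartition_gf_phi.
have := congr1 (tris 2) overpartition_gf_phi.
rewrite tris0M tris1M tris2M !tris1 // tris0_phi tris1_phi tris2_phi -/p -/a -/b /=.
move: (tris 0 p) (tris 1 p) (tris 2 p) => p0 p1 p2 e2 e1 e0.
have Ua := expand3_phi_unit; rewrite -/a in Ua.
have E0 : p0 * D = a ^+ 2.
  (* Component 0 of (p phi) times the cofactor a^2 - 2 a b t + 4 b^2 t^2, t = q^(1/3), whose product
     with phi is D. The other two components follow by back-substitution, a being invertible. *)
  transitivity (a ^+ 2 * (p0 * a + q * (p1 * 0 + p2 * (b *+ 2)))
    - 2%:R * q * b * a * (p0 * 0 + p1 * (b *+ 2) + p2 * a)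
    + 4%:R * q * b ^+ 2 * (p0 * (b *+ 2) + p1 * a + q * (p2 * 0))).
    by rewrite /D; ring.
  by rewrite e0 e1 e2; ring.
have E1 : p1 * D = - (2%:R * a * b).
  apply: (mulIr Ua); transitivity
    ((p0 * (b *+ 2) + p1 * a + q * (p2 * 0)) * D - 2%:R * b * (p0 * D)).
    by ring.
  by rewrite e1 E0; ring.
have E2 : p2 * D = 4%:R * b ^+ 2.
  apply: (mulIr Ua); transitivity
    ((p0 * 0 + p1 * (b *+ 2) + p2 * a) * D - 2%:R * b * (p1 * D)).
    by ring.
  by rewrite e2 E1; ring.
by split; rewrite -?E0 -?E1 -?E2 (mulrK D_unit).
Qed.

(** The signs (-1)^n and (-1)^(3n + r) differ by (-1)^r, hence the factor in front of the
    component. *)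
Lemma p3bar_tris r :
  Fps (fun n => (p3bar (3 * n + r))%:Z) (- q) = (-1) ^+ r * tris r (p ^+ 3).
Proof.
rewrite comp_Nq -rmorphXn tris_sgn_subst mulrA -expr2 sqrr_sign mul1r.
by rewrite -p3bar_gf.
Qed.

(** Brings every term to the common denominator D^3, after which the component formulas are
    polynomial identities. *)
Lemma invD k : D^-1 ^+ k = D * D^-1 ^+ k.+1.
Proof. by rewrite exprS mulrA mulrV ?D_unit // mul1r. Qed.

(** With x^3 = 8 q b^3: a^6 - 7 a^3 x^3 + x^6 = D^2 - 9 a^3 x^3, and 9 * 8 = 72. The next two
    components work alike, with remainders 9 a^2 x^4 and -9 a x^5. *)
Lemma tris0_p3 : (-1) ^+ 0 * tris 0 (p ^+ 3) =
  D^-1 + (- (q * a ^+ 3 * b ^+ 3 * D^-1 ^+ 3)) *+ 72.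
Proof.
have [p0 p1 p2] := tris_p; have -> : p ^+ 3 = p * (p * p) by ring.
rewrite !(tris0M, tris1M, tris2M) p0 p1 p2 -[X in _ = X + _]expr1 2!invD.
by move: D^-1 => d; rewrite /D; ring.
Qed.

Lemma tris1_p3 : (-1) ^+ 1 * tris 1 (p ^+ 3) =
  6%:R * (a ^+ 2 * D^-1 ^+ 2) * b + (- (q * a ^+ 2 * b ^+ 4 * D^-1 ^+ 3)) *+ 144.
Proof.
have [p0 p1 p2] := tris_p; have -> : p ^+ 3 = p * (p * p) by ring.
rewrite !(tris0M, tris1M, tris2M) p0 p1 p2 (invD 2).
by move: D^-1 => d; rewrite /D; ring.
Qed.

Lemma tris2_p3 : (-1) ^+ 2 * tris 2 (p ^+ 3) =
  24%:R * (a ^+ 1 * D^-1 ^+ 2) * b ^+ 2 + (- (q * a * b ^+ 5 * D^-1 ^+ 3)) *+ 288.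
Proof.
have [p0 p1 p2] := tris_p; have -> : p ^+ 3 = p * (p * p) by ring.
rewrite !(tris0M, tris1M, tris2M) p0 p1 p2 (invD 2).
by move: D^-1 => d; rewrite /D; ring.
Qed.

Lemma expand3_div : a / phi ^+ 4 = D^-1.
Proof.
rewrite -normE invrM ?D_unit ?expand3_phi_unit //.
by rewrite mulrA divrr ?mul1r // expand3_phi_unit.
Qed.

Lemma expand3_divX k : a ^+ k.+2 / phi ^+ 8 = a ^+ k * D^-1 ^+ 2.
Proof. by rewrite -expand3_div exprMn exprVn -exprM -[k.+2]addn2 exprD -mulrA. Qed.

End Dissection.

Theorem theorem3p4 :
  [/\ Fps (fun n => (p3bar (3 * n))%:Z) (- q)
        = phi (q ^+ 3) / phi q ^+ 4 %[mod 9 * 2 ^+ 3],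
      Fps (fun n => (p3bar (3 * n + 1))%:Z) (- q)
        = 6%:R * (phi (q ^+ 3) ^+ 4 / phi q ^+ 8) * B (- q)
          %[mod 9 * 2 ^+ 4]
    & Fps (fun n => (p3bar (3 * n + 2))%:Z) (- q)
        = 24%:R * (phi (q ^+ 3) ^+ 3 / phi q ^+ 8) * B (- q) ^+ 2
          %[mod 9 * 2 ^+ 5]].
Proof.
have p3bar0 : Fps (fun n => (p3bar (3 * n))%:Z) =
    Fps (fun n => (p3bar (3 * n + 0))%:Z).
  by apply: fpsP => n; rewrite /= addn0.
rewrite p3bar0 !p3bar_tris tris0_p3 tris1_p3 tris2_p3 comp_q3 comp_q comp_Nq.
rewrite expand3_div !expand3_divX; split.
- exact: (@eqmod_addMn 72).
- exact: (@eqmod_addMn 144).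
exact: (@eqmod_addMn 288).
Qed.
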